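(* Let $G$ be a post-critically finite self-similar group with alphabet $S$, acting on $S^{\mathbb N}$, let $\xi\in S^{\mathbb N}$ be a ray, and let $\Gamma$ be the Schreier graph of the orbit $G\xi$ with respect to the nucleus of $G$. Then the domino problem on $\Gamma$ is decidable.
   Context: Self-similar groups. A self-similar group is a group $G$ with a finite set $S$ (alphabet) and a map $\Phi\colon G\times S\to S\times G$ such that $\Phi(1,s)=(s,1)$ and $\Phi(gh,s)=(s'',g'h')$ whenever $\Phi(h,s)=(s',h')$ and $\Phi(g,s')=(s'',g')$. Then $G$ acts on the set $S^{\mathbb N}$ of right-infinite words (rays) by $g(\xi_1\xi_2\dots)=\xi_1'\,g_1(\xi_2\xi_3\dots)$, where $\Phi(g,\xi_1)=(\xi_1',g_1)$, applied recursively. The full transducer of $G$ is the graph with vertex set $G$ and an edge from $g$ to $h$ labelled $s|t$ (input $s$, output $t$) whenever $\Phi(g,s)=(t,h)$. The group is contracting if there is a finite subtransducer $N$ of the full transducer such that every path is eventually contained in $N$; the minimal such $N$ is called the nucleus, and $N$ also denotes its set of vertices, a finite subset of $G$. A contracting self-similar group is post-critically finite if its nucleus contains only finitely many left-infinite paths ending at a non-trivial state. Schreier graph. The Schreier graph of the orbit $G\xi$ with respect to the nucleus $N$ has vertex set $G\xi$ and, for every $g\in N$ and $x\in G\xi$, an edge labelled $g$ from $x$ to $g(x)$. Domino problem. For a finite set $A$ and an $A$-labelled graph $\Gamma$ with vertex set $V$, edge set $E$, where $e\in E$ has tail $e^-$, head $e^+$ and label $\lambda(e)\in A$, the domino problem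 on $\Gamma$ is the decision problem: given a finite set $B$ and $\Theta\subseteq B\times A\times B$, does there exist $\tau\colon V\to B$ with $(\tau(e^-),\lambda(e),\tau(e^+))\in\Theta$ for all $e\in E$? It is decidable if some algorithm solves it (for the given fixed graph $\Gamma$). *)

(* Defs.v *)
From mathcomp Require Import all_boot finmap all_classical.

Set Implicit Arguments.
Unset Strict Implicit.
Unset Printing Implicit Defensive.

Local Open Scope classical_set_scope.
Local Open Scope nat_scope.

(* Total recursive functions of several natural variables, in the style of
   Goedel and Kleene: minimisation is only allowed when it is everywhere
   defined.  Each clause characterises the new function pointwise, so the class
   is closed under extensional equality. *)
Inductive recursive : forall n, (n.-tuple nat -> nat) -> Prop :=
| recursive_zero n (f : n.-tuple nat -> nat) :
    (forall v, f v = 0) -> recursive f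
| recursive_succ (f : 1.-tuple nat -> nat) :
    (forall k, f [tuple k] = k.+1) -> recursive f
| recursive_proj n (i : 'I_n) (f : n.-tuple nat -> nat) :
    (forall v, f v = tnth v i) -> recursive f
| recursive_comp m n (h : m.-tuple nat -> nat)
    (g : 'I_m -> n.-tuple nat -> nat) (f : n.-tuple nat -> nat) :
    recursive h -> (forall i, recursive (g i)) ->
    (forall v, f v = h [tuple g i v | i < m]) -> recursive f
| recursive_primrec n (g : n.-tuple nat -> nat) (h : n.+2.-tuple nat -> nat)
    (f : n.+1.-tuple nat -> nat) :
    recursive g -> recursive h ->
    (forall v, f (cons_tuple 0 v) = g v) ->
    (forall k v, f (cons_tuple k.+1 v) =
       h (cons_tuple k (cons_tuple (f (cons_tuple k v)) v))) ->
    recursive f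
| recursive_min n (g : n.+1.-tuple nat -> nat) (f : n.-tuple nat -> nat) :
    recursive g ->
    (forall v, g (cons_tuple (f v) v) = 0) ->
    (forall v k, k < f v -> g (cons_tuple k v) <> 0) ->
    recursive f.

(* [code] is meant to be an effective numbering of the instances. *)
Definition algorithmically_decidable (I : Type) (code : I -> nat)
    (P : I -> Prop) : Prop :=
  exists f : 1.-tuple nat -> nat,
    recursive f /\ forall i, f [tuple code i] = `[< P i >] :> nat.

Record labelled_graph (A : Type) := LabelledGraph {
  vertex : Type;
  edge : Type;
  edge_tail : edge -> vertex;
  edge_head : edge -> vertex;
  edge_label : edge -> A }.

(* The finite set B of an instance is taken to be {0, ..., k-1} = 'I_k. *)
Record domino_instance (A : finType) := DominoInstance {
  ncolours : nat;
  allowed : {set 'I_ncolours * A * 'I_ncolours} }.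

(* The word k b_1 a_1 b'_1 b_2 a_2 b'_2 ... listing the allowed triples, each
   label being replaced by its rank in the enumeration of A. *)
Definition domino_word (A : finType) (I : domino_instance A) : seq nat :=
  ncolours I ::
  flatten [seq [:: val t.1.1; val (enum_rank t.1.2); val t.2]
          | t <- enum (allowed I)].

Definition domino_code (A : finType) (I : domino_instance A) : nat :=
  CodeSeq.code (domino_word I).

Definition domino_solvable (A : finType) (Gamma : labelled_graph A)
    (I : domino_instance A) : Prop :=
  exists tau : vertex Gamma -> 'I_(ncolours I),
    forall e : edge Gamma,
      (tau (edge_tail e), edge_label e, tau (edge_head e)) \in allowed I.

Definition domino_problem_decidable (A : finType) (Gamma : labelled_graph A) :=
  algorithmically_decidable (@domino_code A) (domino_solvable Gamma).

Record selfSimilarGroup (S : finType) := SelfSimilarGroup {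
  carrier :> groupType;
  Phi : carrier * S -> S * carrier;
  Phi_one : forall s, Phi (1%g, s) = (s, 1%g);
  Phi_mul : forall g h s s' s'' g' h',
    Phi (h, s) = (s', h') -> Phi (g, s') = (s'', g') ->
    Phi ((g * h)%g, s) = (s'', (g' * h')%g) }.

Section SelfSimilar.
Variables (S : finType) (G : selfSimilarGroup S).

Fixpoint act (g : G) (x : nat -> S) (n : nat) : S :=
  let: (t, h) := Phi (g, x 0) in
  if n is n'.+1 then act h (fun i => x i.+1) n' else t.

Lemma actM (g h : G) (x : nat -> S) : act g (act h x) = act (g * h)%g x.
Proof.
apply/funext => n; elim: n g h x => [|n IH] g h x /=.
- case Eh: (Phi (h, x 0)) => [s' h']; case Eg: (Phi (g, s')) => [s'' g'].
  by rewrite (Phi_mul Eh Eg).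
- case Eh: (Phi (h, x 0)) => [s' h']; case Eg: (Phi (g, s')) => [s'' g'].
  by rewrite (Phi_mul Eh Eg) -IH.
Qed.

Definition ray_orbit (xi : nat -> S) : set (nat -> S) :=
  range (fun g : G => act g xi).

Lemma act_ray_orbit (xi : nat -> S) (g : G) (x : ray_orbit xi) :
  act g (val x) \in ray_orbit xi.
Proof.
case: x => x /= /set_mem [h _ <-]; apply: mem_set.
by exists (g * h)%g; rewrite ?actM.
Qed.

(* An edge of the full transducer: source, input, output, target. *)
Definition transition : Type := G * S * S * G.
Definition source (e : transition) : G := e.1.1.1.
Definition input (e : transition) : S := e.1.1.2.
Definition output (e : transition) : S := e.1.2.
Definition target (e : transition) : G := e.2.
Definition is_transition (e : transition) : Prop :=
  Phi (source e, input e) = (output e, target e).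

Definition right_path (p : nat -> transition) : Prop :=
  (forall i, is_transition (p i)) /\
  (forall i, source (p i.+1) = target (p i)).

(* Edges of a left-infinite path are numbered backwards: [p 0] is the last. *)
Definition left_path (p : nat -> transition) : Prop :=
  (forall i, is_transition (p i)) /\
  (forall i, target (p i.+1) = source (p i)).

(* A subtransducer, being itself a transducer over the same alphabet, contains
   all transitions issuing from its states. *)
Definition subtransducer (N : {fset G}) : Prop :=
  forall e, is_transition e -> source e \in N -> target e \in N.

Definition absorbing (N : {fset G}) : Prop :=
  subtransducer N /\
  forall p, right_path p -> exists n, forall i, n <= i -> source (p i) \in N.

Definition contracting : Prop := exists N, absorbing N.

Definition is_nucleus (N : {fset G}) : Prop :=
  absorbing N /\ forall M, absorbing M -> (N `<=` M)%fset.

Definition singular_left_paths (N : {fset G}) : set (nat -> transition) :=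
  [set p | [/\ left_path p,
               forall i, source (p i) \in N /\ target (p i) \in N
             & target (p 0) <> 1%g]].

Definition post_critically_finite : Prop :=
  contracting /\
  forall N, is_nucleus N -> finite_set (singular_left_paths N).

Definition schreier_graph (N : {fset G}) (xi : nat -> S) : labelled_graph N :=
  @LabelledGraph N (ray_orbit xi) (N * ray_orbit xi)%type
    (fun e => e.2)
    (fun e => exist _ (act (val e.1) (val e.2)) (act_ray_orbit (val e.1) e.2))
    (fun e => e.1).

End SelfSimilar.

Arguments contracting {S} G.
Arguments post_critically_finite {S} G.

(* Main.v *)
Require Import Defs.
From mathcomp Require Import all_boot finmap all_classical.
From mathcomp Require Import zify.

Set Implicit Arguments.
Unset Strict Implicit.
Unset Printing Implicit Defensive.

(** Cut every ray after its first [n] letters.  A transition of the nucleus that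
    has become trivial after [n] letters joins [u y] to [u' y] for every tail
    [y], so it is an edge of a finite graph on the words [u] of length [n] that
    are prefixes of rays of the orbit.  The paths of length [n] in the nucleus that
    end at a non-trivial state are truncations of the finitely many singular
    left-infinite paths ([boundary_exists]), so that their number is bounded
    independently of [n]; their input and output words form the boundary of the
    finite graph.  The graph for [n + 1] consists, for each last letter, of a copy
    of a union of components of the graph for [n], glued along the boundary.
    Hence the set of colourings of the boundary that extend to a solution on the
    finite graph (the boundary patterns) for [n + 1] is a function of the set for
    [n] ([boundary_patternS]).

    The function depends on [n], through the labels of the boundary edges and
    through the question which boundary words followed by a letter are prefixes
    in the orbit.  The ray is arbitrary and the group need not act transitively
    on words, so these data could look incomputable; but they are ultimately
    periodic in [n].  Indeed, if infinitely many truncations of one residue of a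
    periodic left-infinite word, followed by [u], are such prefixes, then all of
    them are ([orbit_word_recurrent]).  So finitely many gluings, followed by the
    iteration of a single one, produce the sets of boundary patterns for all
    large [n] in one residue class.

    Some edges of the Schreier graph never become trivial.  There are finitely
    many of them, their ends are periodic rays, and the condition that they impose
    on the boundary patterns does not depend on [n] if [n] is a multiple of the
    period ([singular_edge]).  A solution on the whole graph exists if and only if
    this closing condition can be met for all large [n] of this kind: one direction
    restricts a solution ([solvable_closable]), the other takes the limit of partial
    solutions along an ultrafilter ([closable_solvable]).

    As a set of patterns takes finitely many values, it suffices to iterate a
    computable number of times ([iter_bounded]).  Sets of patterns are coded by
    numbers and gluing is expressed by bounded sums and searches, so that the
    test is a recursive function of the code of the instance
    ([gluing_decidable]). *)

(** * Recursive functions of an environment *)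

(** Variables are read off an environment, with de Bruijn binders, so that
    weakening costs nothing; only finitely many variables may matter. *)
Definition computable (f : (nat -> nat) -> nat) : Prop :=
  exists n, exists2 g : n.-tuple nat -> nat,
    recursive g & forall e, f e = g [tuple e (val i) | i < n].

(** The number of variables can be made as large as one likes, so that several
    functions may be assumed to read the same ones. *)
Lemma computable_widen f : computable f -> exists n, forall m, n <= m ->
  exists2 g : m.-tuple nat -> nat,
    recursive g & forall e, f e = g [tuple e (val i) | i < m].
Proof.
case=> n [g rg fg]; exists n => m le_nm.
exists (fun v => g [tuple tnth v (widen_ord le_nm i) | i < n]).
  apply: (@recursive_comp n m g (fun i v => tnth v (widen_ord le_nm i))) => //.
  by move=> i; exact: recursive_proj.
move=> e; rewrite fg; congr g; apply: eq_from_tnth => i.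
by rewrite !tnth_mktuple.
Qed.

Lemma computable_var i : computable (fun e => e i).
Proof.
exists i.+1, (fun v => tnth v ord_max); first exact: recursive_proj.
by move=> e; rewrite tnth_mktuple.
Qed.

Lemma computable_0 : computable (fun=> 0).
Proof. by exists 0, (fun=> 0) => //; apply: recursive_zero. Qed.

Lemma computable_recursive n (h : n.-tuple nat -> nat)
    (f : 'I_n -> (nat -> nat) -> nat) :
  recursive h -> (forall i, computable (f i)) ->
  computable (fun e => h [tuple f i e | i < n]).
Proof.
move=> rh cf; have /choice [w wP] := fun i => computable_widen (cf i).
pose m := \max_i w i.
have /choice [g gP] i : exists g : m.-tuple nat -> nat, recursive g /\
    forall e, f i e = g [tuple e (val j) | j < m].
  by have [|g rg eg] := wP i m; [exact: leq_bigmax|exists g].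
exists m, (fun v => h [tuple g i v | i < n]).
  by apply: (@recursive_comp n m h g) => // i; case: (gP i).
move=> e; congr h; apply: eq_from_tnth => i; rewrite !tnth_mktuple.
by case: (gP i) => _ ->.
Qed.

Lemma computable_succ f : computable f -> computable (fun e => (f e).+1).
Proof.
move=> cf; pose h (v : 1.-tuple nat) := (thead v).+1.
suff: computable (fun e => h [tuple f e | i < 1]).
  by move=> [n [g rg eg]]; exists n, g => // e; rewrite -eg /h /thead tnth_mktuple.
by apply: (@computable_recursive 1 h (fun _ => f)) => //; apply: recursive_succ.
Qed.

Lemma tuple_env n (v : n.-tuple nat) : [tuple nth 0 v (val i) | i < n] = v.
Proof. by apply: eq_from_tnth => i; rewrite tnth_mktuple (tnth_nth 0). Qed.

(** Primitive recursion; in the third hypothesis the variables [0] and [1] of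
    the environment are the counter and the value computed so far. *)
Lemma computable_iteri t F x :
  computable t -> computable x ->
  computable (fun e => F (fun i => e i.+2) (e 0) (e 1)) ->
  computable (fun e => iteri (t e) (F e) (x e)).
Proof.
move=> ct /computable_widen [n1 xP] /computable_widen [n2 FP].
pose n := maxn n1 n2.
have [gx rgx xE] := xP n (leq_maxl _ _).
have [|gF rgF FE] := FP n.+2; first by rewrite /n; lia.
pose f (v : n.+1.-tuple nat) :=
  iteri (thead v) (F (nth 0 (behead v))) (x (nth 0 (behead v))).
have rf : recursive f.
  apply: (recursive_primrec rgx rgF) => [v|k v].
    by rewrite /f /= xE tuple_env.
  rewrite [LHS]/f /thead !(tnth_nth 0) /= -/(iteri _ _ _).
  have := FE (nth 0 (cons_tuple k (cons_tuple (f (cons_tuple k v)) v))).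
  by rewrite tuple_env => <-.
pose w (i : 'I_n.+1) := fun e : nat -> nat =>
  oapp (fun j : 'I_n => e j) (t e) (unlift ord0 i).
have cw i : computable (w i).
  rewrite /w; case: unlift => [j|] /=; [exact: computable_var|exact: ct].
have [m [g rg gE]] := computable_recursive rf cw.
exists m, g => // e; rewrite -gE /f /thead tnth_mktuple /w unlift_none /=.
set s := behead _; have sE : s = [tuple e (val i) | i < n] :> seq nat.
  rewrite /s -[behead _]/(tval [tuple of behead (mktuple (w^~ e))]).
  congr tval; apply: eq_from_tnth => i.
  rewrite tnth_behead !tnth_mktuple /w.
  have -> : inord i.+1 = lift ord0 i by apply: val_inj; rewrite /= inordK ?ltnS.
  by rewrite liftK.
rewrite sE [x (nth _ _)]xE xE tuple_env.
have FE' k y : F e k y = F (nth 0 [tuple e (val i) | i < n]) k y.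
  pose e' := fun i => if i is j.+1 then if j is l.+1 then e l else y else k.
  have /= -> := FE e'.
  have /= -> := FE (fun i => nth 0 [:: k, y & [tuple e (val i) | i < n]] i).
  congr gF; apply: eq_from_tnth => -[[|[|i]] ilt]; rewrite !tnth_mktuple //=.
  by rewrite (nth_map (Ordinal (ilt : i < n))) ?size_enum_ord ?nth_enum_ord.
by elim: (t e) => //= k ->; rewrite FE'.
Qed.

Lemma computable_eq f g : f =1 g -> computable f -> computable g.
Proof. by move=> fg [n [h rh hE]]; exists n, h => // e; rewrite -fg. Qed.

Lemma computable_iter t F x :
  computable t -> computable x ->
  computable (fun e => F (fun i => e i.+2) (e 1)) ->
  computable (fun e => iter (t e) (F e) (x e)).
Proof.
move=> ct cx cF; apply: (@computable_eq (fun e => iteri (t e) (fun _ => F e) (x e))).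
  by move=> e; elim: (t e) => //= n ->.
exact: computable_iteri.
Qed.

Lemma computable_const n : computable (fun=> n).
Proof. by elim: n => [|n /computable_succ //]; exact: computable_0. Qed.

Lemma computable_add f g :
  computable f -> computable g -> computable (fun e => f e + g e).
Proof.
move=> cf cg; apply: (@computable_eq (fun e => iter (g e) succn (f e))).
  by move=> e; rewrite iter_succn.
apply: (computable_iter (F := fun _ => succn)) => //.
exact: computable_succ (computable_var 1).
Qed.

Lemma computable_mul f g :
  computable f -> computable g -> computable (fun e => f e * g e).
Proof.
move=> cf cg; apply: (@computable_eq (fun e => iter (g e) (addn (f e)) 0)).
  by move=> e; rewrite iter_addn_0.
apply: (computable_iter (F := fun e => addn (f e)) cg computable_0).
apply: computable_add (computable_var 1).
have [n [h rh hE]] := cf.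
have := computable_recursive rh (fun i => computable_var (val i).+2).
by apply: computable_eq => e; rewrite hE.
Qed.

Lemma computable_rename f (s : nat -> nat) :
  computable f -> computable (fun e => f (fun i => e (s i))).
Proof.
move=> [n [h rh hE]].
have := computable_recursive rh (fun i => computable_var (s (val i))).
by apply: computable_eq => e; rewrite hE.
Qed.

Lemma computable_exp f g :
  computable f -> computable g -> computable (fun e => f e ^ g e).
Proof.
move=> cf cg; apply: (@computable_eq (fun e => iter (g e) (muln (f e)) 1)).
  by move=> e; rewrite iter_muln_1.
apply: (computable_iter (F := fun e => muln (f e)) cg (computable_const 1)).
exact: computable_mul (computable_rename _ cf) (computable_var 1).
Qed.

Lemma computable_sub f g :
  computable f -> computable g -> computable (fun e => f e - g e).
Proof.
move=> cf cg; apply: (@computable_eq (fun e => iter (g e) predn (f e))).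
  by move=> e; rewrite iter_predn.
apply: (computable_iter (F := fun _ => predn)) => //.
apply: (@computable_eq (fun e => iteri (e 1) (fun k _ => k) 0)).
  by move=> e /=; case: (e 1).
apply: (computable_iteri (F := fun _ k _ => k)) (computable_var 1) computable_0 _.
exact: computable_var 0.
Qed.

Lemma computable_leq f g :
  computable f -> computable g -> computable (fun e => f e <= g e).
Proof.
move=> cf cg; apply: (@computable_eq (fun e => 1 - (f e - g e))) => [e|].
  by rewrite /leq; case: (f e - g e).
exact: computable_sub (computable_const 1) (computable_sub cf cg).
Qed.

Lemma computable_andb (b c : (nat -> nat) -> bool) :
  computable b -> computable c -> computable (fun e => b e && c e).
Proof.
move=> cb cc; apply: (@computable_eq (fun e => b e * c e)) => [e|].
  by rewrite mulnb.
exact: computable_mul.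
Qed.

Lemma computable_eqn f g :
  computable f -> computable g -> computable (fun e => f e == g e).
Proof.
move=> cf cg; apply: (@computable_eq (fun e => (f e <= g e) && (g e <= f e))).
  by move=> e; rewrite eqn_leq.
by apply: computable_andb; apply: computable_leq.
Qed.

Lemma computable_all (T : eqType) (s : seq T) (P : T -> (nat -> nat) -> bool) :
  (forall x, x \in s -> computable (P x)) ->
  computable (fun e => all (P^~ e) s).
Proof.
elim: s => [_|x s IHs cP] /=; first exact: computable_const 1.
apply: computable_andb; first by apply: cP; rewrite mem_head.
by apply: IHs => y ys; apply: cP; rewrite in_cons ys orbT.
Qed.

Lemma computable_sum t F :
  computable t -> computable (fun e => F (fun i => e i.+1) (e 0)) ->
  computable (fun e => \sum_(i < t e) F e i).
Proof.
move=> ct cF.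
apply: (@computable_eq (fun e => iteri (t e) (fun k a => a + F e k) 0)) => [e|].
  by elim: (t e) => [|n IHn] /=; rewrite ?big_ord0 // big_ord_recr IHn.
apply: (computable_iteri (F := fun e k a => a + F e k)) ct computable_0 _.
apply: computable_add (computable_var 1) _.
exact: (computable_rename (fun i => if i is j.+1 then j.+2 else 0) cF).
Qed.

Lemma sum_ltn q n : \sum_(i < n) (i < q : nat) = minn n q.
Proof.
by elim: n => [|n IHn]; rewrite ?big_ord0 ?big_ord_recr /= ?IHn ?min0n //; lia.
Qed.

Lemma computable_divn f g :
  computable f -> computable g -> computable (fun e => f e %/ g e).
Proof.
move=> cf cg.
(* The quotient counts the positive multiples of the divisor up to [f e]; the
   test [1 <= g e] accounts for the convention that division by 0 gives 0. *)
apply: (@computable_eq (fun e =>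
    \sum_(i < f e) ((1 <= g e) && (i.+1 * g e <= f e)))) => [e|].
  have [->|g_gt0] := posnP (g e); first by rewrite divn0 big1.
  under eq_bigr => i _ do rewrite -leq_divRL //.
  by rewrite sum_ltn (minn_idPr (leq_div _ _)).
apply: (computable_sum (F := fun e i => (1 <= g e) && (i.+1 * g e <= f e))) => //.
have cg' := computable_rename succn cg.
apply: computable_andb; first exact: computable_leq (computable_const 1) cg'.
apply: computable_leq (computable_rename succn cf).
exact: computable_mul (computable_succ (computable_var 0)) cg'.
Qed.

Lemma computable_modn f g :
  computable f -> computable g -> computable (fun e => f e %% g e).
Proof.
move=> cf cg; apply: (@computable_eq (fun e => f e - f e %/ g e * g e)) => [e|].
  by rewrite {1}(divn_eq (f e) (g e)) addKn.
exact: computable_sub cf (computable_mul (computable_divn cf cg) cg).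
Qed.

Lemma computable_exists t (P : (nat -> nat) -> nat -> bool) :
  computable t -> computable (fun e => P (fun i => e i.+1) (e 0)) ->
  computable (fun e => [exists i : 'I_(t e), P e i]).
Proof.
move=> ct cP; apply: (@computable_eq (fun e => 0 < \sum_(i < t e) P e i)).
  move=> e; congr nat_of_bool; rewrite lt0n sum_nat_eq0 negb_forall.
  by apply: eq_existsb => i; case: (P e i).
apply: computable_leq (computable_const 1) _.
exact: (computable_sum (F := P)).
Qed.

(** * Reading an instance off its code *)

#[local] Arguments CodeSeq.code : simpl never.

(** The code of [n :: s] is [2 ^ n] times the odd number [2 m + 1], where [m] is
    the code of [s]: the head is a 2-adic valuation. *)
Definition code_tail (c : nat) : nat := c %/ 2 ^ (logn 2 c).+1.

Lemma logn_code n s : logn 2 (CodeSeq.code (n :: s)) = n.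
Proof.
rewrite [CodeSeq.code _]/(_ * _) lognM ?expn_gt0 // pfactorK // -[RHS]addn0.
congr (_ + _).
by rewrite lognE /= dvdn2 /= odd_double.
Qed.

Lemma code_tailE n s : code_tail (CodeSeq.code (n :: s)) = CodeSeq.code s.
Proof.
rewrite /code_tail logn_code [CodeSeq.code _]/(_ * _) expnSr divnMl ?expn_gt0 //.
by rewrite divn2 /= uphalf_double.
Qed.

Lemma code_tail0 : code_tail 0 = 0.
Proof. by rewrite /code_tail div0n. Qed.

Lemma size_leq_code s : size s <= CodeSeq.code s.
Proof.
elim: s => // n s IHs; rewrite [CodeSeq.code _]/(_ * _).
apply: leq_trans (leq_pmull _ _); last by rewrite expn_gt0.
by rewrite ltnS -addnn; apply: leq_trans IHs (leq_addr _ _).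
Qed.

Lemma computable_logn2 f : computable f -> computable (fun e => logn 2 (f e)).
Proof.
move=> cf.
apply: (@computable_eq (fun e => \sum_(i < f e) (f e %% 2 ^ i.+1 == 0))) => [e|].
  have [->|f_gt0] := posnP (f e); first by rewrite big_ord0.
  under eq_bigr => i _ do rewrite -/(dvdn _ _) pfactor_dvdn //.
  by rewrite sum_ltn (minn_idPr (ltnW (ltn_logl _ f_gt0))).
apply: (computable_sum (F := fun e i => f e %% 2 ^ i.+1 == 0)) => //.
apply: computable_eqn computable_0; apply: computable_modn.
  exact: computable_rename succn cf.
exact: computable_exp (computable_const 2) (computable_succ (computable_var 0)).
Qed.

Lemma computable_code_tail f : computable f -> computable (fun e => code_tail (f e)).
Proof.
move=> cf; apply: (computable_divn cf); apply: computable_exp (computable_const 2) _.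
exact: computable_succ (computable_logn2 cf).
Qed.

(** The triples start at the positions [3 i + 1] of the word coded by [c]; the
    test [0 < e] ensures that the word has such a position, and [c] exceeds the
    number of triples because a code is at least the length of its word. *)
Definition lists (c b a b' : nat) : bool :=
  [exists i : 'I_c, let e := iter (3 * i).+1 code_tail c in
    [&& 0 < e, logn 2 e == b, logn 2 (code_tail e) == a
      & logn 2 (code_tail (code_tail e)) == b']].

Lemma computable_lists c b a b' :
  computable c -> computable b -> computable a -> computable b' ->
  computable (fun e => lists (c e) (b e) (a e) (b' e)).
Proof.
move=> cc cb ca cb'.
apply: (computable_exists (P := fun e i =>
   let x := iter (3 * i).+1 code_tail (c e) in
   [&& 0 < x, logn 2 x == b e, logn 2 (code_tail x) == a e
     & logn 2 (code_tail (code_tail x)) == b' e])) => //.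
have cx : computable (fun e => iter (3 * e 0).+1 code_tail (c (fun i => e i.+1))).
  apply: (computable_iter (F := fun _ => code_tail)).
  - exact: computable_succ (computable_mul (computable_const 3) (computable_var 0)).
  - exact: computable_rename succn cc.
  - exact: computable_code_tail (computable_var 1).
apply: computable_andb; first exact: computable_leq (computable_const 1) cx.
apply: computable_andb.
  exact: computable_eqn (computable_logn2 cx) (computable_rename succn cb).
have ctx := computable_code_tail cx.
apply: computable_andb.
  exact: computable_eqn (computable_logn2 ctx) (computable_rename succn ca).
have cttx := computable_code_tail ctx.
exact: computable_eqn (computable_logn2 cttx) (computable_rename succn cb').
Qed.

(** Colours enter the gluings below as numbers; a number that is not a colour of
    the instance is in no permitted triple. *)
Definition permits (A : finType) (I : domino_instance A) (b : nat) (a : A) (b' : nat) :=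
  exists2 t, t \in allowed I & [/\ val t.1.1 = b, t.1.2 = a & val t.2 = b'].

Lemma logn_domino_code (A : finType) (I : domino_instance A) :
  logn 2 (domino_code I) = ncolours I.
Proof. exact: logn_code. Qed.

Lemma listsP (A : finType) (I : domino_instance A) b a b' :
  lists (domino_code I) b (enum_rank a) b' <-> permits I b a b'.
Proof.
rewrite /lists; set c := domino_code I.
set f := fun t : 'I_(ncolours I) * A * 'I_(ncolours I) =>
  [:: val t.1.1; val (enum_rank t.1.2); val t.2].
pose l := enum (allowed I).
have iterE i : code_tail (iter (3 * i) code_tail c) =
    CodeSeq.code (flatten [seq f t | t <- drop i l]).
  have tail3 x y z r :
      iter 3 code_tail (CodeSeq.code [:: x, y, z & r]) = CodeSeq.code r.
    by rewrite !iterSr !code_tailE.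
  rewrite -iterS iterSr code_tailE -/f -/l; elim: i l => [|i IHi] [|t l] //.
    by rewrite iter_fix ?code_tail0.
  rewrite [drop _ _]/= -IHi mulnS addnC iterD; congr (iter _ _ _); exact: tail3.
split=> [/existsP[i]|[t tI [<- <- <-]]] /=; rewrite ?iterE.
  case El: (drop i l) => [|t l'] //=; rewrite logn_code code_tailE logn_code.
  rewrite code_tailE logn_code => /and4P[_ /eqP <- /eqP E /eqP <-].
  exists t; last by split=> //; apply: enum_rank_inj; apply: val_inj.
  by rewrite -mem_enum; apply: (@mem_drop i); rewrite -/l El mem_head.
have tl : t \in l by rewrite mem_enum.
have lt_c : index t l < c.
  rewrite -index_mem in tl; apply: leq_trans tl _.
  have: size l <= size (domino_word I).
    by rewrite /= -/l; elim: (l) => //= u l' IHl; rewrite !ltnS; lia.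
  by move=> /leq_trans; apply; exact: size_leq_code.
apply/existsP; exists (Ordinal lt_c); rewrite iterE /= (drop_nth t) ?index_mem //.
rewrite nth_index //= logn_code code_tailE logn_code code_tailE logn_code !eqxx.
by rewrite muln_gt0 expn_gt0.
Qed.

(** * Gluing sets of patterns *)

Definition digit (B x i : nat) : nat := x %/ B ^ i %% B.

Lemma computable_digit B x i : computable B -> computable x -> computable i ->
  computable (fun e => digit (B e) (x e) (i e)).
Proof.
move=> cB cx ci; apply: computable_modn => //; apply: computable_divn => //.
exact: computable_exp.
Qed.

Lemma digit_sum B n f : (forall i, i < n -> f i < B) ->
  let x := \sum_(i < n) B ^ i * f i in
  x < B ^ n /\ forall i, i < n -> digit B x i = f i.
Proof.
elim: n => [|n IHn] f_lt /=; first by rewrite big_ord0.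
have [|x_lt xE] := IHn; first by move=> i /ltnW/f_lt.
have fn_lt := f_lt n (ltnSn n).
have B_gt0 : 0 < B by apply: leq_ltn_trans fn_lt.
rewrite big_ord_recr /=; set x := \sum_(i < n) _ in x_lt xE *; split.
  rewrite expnSr; have : B ^ n * (f n).+1 <= B ^ n * B by rewrite leq_mul2l fn_lt orbT.
  by rewrite mulnS; lia.
move=> i; rewrite ltnS leq_eqVlt => /orP[/eqP->|lt_in].
  rewrite /digit addnC mulnC divnMDl ?expn_gt0 ?B_gt0 // divn_small // addn0.
  by rewrite modn_small.
rewrite -(xE _ lt_in) /digit.
have -> : B ^ n = B ^ (n - i.+1) * B * B ^ i.
  by rewrite -expnSr -expnD; congr (_ ^ _); lia.
by rewrite addnC mulnAC divnMDl ?expn_gt0 ?B_gt0 // mulnAC modnMDl.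
Qed.

Lemma digits_exist B n (f : nat -> nat) : (forall i, i < n -> f i < B) ->
  exists2 x, x < B ^ n & forall i, i < n -> digit B x i = f i.
Proof. by case/digit_sum => *; exists (\sum_(i < n) B ^ i * f i). Qed.

Lemma digits_exist_fin (B : nat) (T : finType) (f : T -> nat) :
  (forall x, f x < B) ->
  exists2 y, y < B ^ #|T| & forall x, digit B y (enum_rank x) = f x.
Proof.
move=> f_lt; pose F i := oapp (fun j : 'I_#|T| => f (enum_val j)) 0 (insub i).
have FE i (lt_i : i < #|T|) : F i = f (enum_val (Ordinal lt_i)) by rewrite /F insubT.
have [|y y_lt yE] := @digits_exist B #|T| F; first by move=> i lt_i; rewrite FE.
exists y => // x; rewrite yE ?ltn_ord // (FE _ (ltn_ord _)); congr f.
by rewrite -[RHS]enum_rankK; congr enum_val; apply: val_inj.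
Qed.

Lemma digit_lt B n x i : x < B ^ n -> i < n -> digit B x i < B.
Proof.
by case: n => // n; case: B => [|B _ _]; [rewrite exp0n|exact: ltn_pmod].
Qed.

(** A set of patterns -- assignments of colours to a finite type [D] of
    positions -- is a natural number, its characteristic word in base 2; a
    pattern is itself a number, the word of its colours in base [k].  A gluing
    takes copies of one set of patterns, demands that the label of every seam
    be respected and reads the new pattern off the outlets. *)
Record gluing (D A : finType) := Gluing {
  copies : finType;
  seam : copies * D * A * copies * D -> bool;
  outlet : D * copies * D -> bool }.

Section Gluing.
Variables (D A : finType).
Implicit Types (g : gluing D A).

Definition npatterns (k : nat) := k ^ #|D|.

Definition colour (k j : nat) (d : D) : nat := digit k j (enum_rank d).

(** The number [C] lists one pattern for each copy. *)
Definition piece g k C (s : copies g) : nat := digit (npatterns k) C (enum_rank s).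

Definition fits g c X C : bool :=
  let k := logn 2 c in
  all (fun s => digit 2 X (piece k C s) == 1) (enum (copies g)) &&
  all (fun t : copies g * D * A * copies g * D => let: (s, d, a, s', d') := t in
         lists c (colour k (piece k C s) d) (enum_rank a) (colour k (piece k C s') d'))
      (enum (@seam D A g)).

Definition yields g c j C : bool :=
  let k := logn 2 c in
  all (fun t : D * copies g * D => let: (d, s, d') := t in
         colour k j d == colour k (piece k C s) d')
      (enum (@outlet D A g)).

Definition gluable g c X j : bool :=
  [exists C : 'I_(npatterns (logn 2 c) ^ #|copies g|), fits g c X C && yields g c j C].

Definition glue g c X : nat := \sum_(j < npatterns (logn 2 c)) 2 ^ j * gluable g c X j.

Definition glue_all (gs : seq (gluing D A)) c X := foldl (fun X g => glue g c X) X gs.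

Definition constant_pattern (a : A) c j : bool :=
  [exists b : 'I_(logn 2 c), lists c b (enum_rank a) b &&
     all (fun d => colour (logn 2 c) j d == b) (enum D)].

Definition constant_patterns (a : A) c : nat :=
  \sum_(j < npatterns (logn 2 c)) 2 ^ j * constant_pattern a c j.

Lemma computable_npatterns k :
  computable k -> computable (fun e => npatterns (k e)).
Proof. by move=> ck; apply: computable_exp ck (computable_const _). Qed.

Lemma computable_colour k j d : computable k -> computable j ->
  computable (fun e => colour (k e) (j e) d).
Proof. by move=> ck cj; apply: computable_digit => //; exact: computable_const. Qed.

Lemma computable_glue g c X : computable c -> computable X ->
  computable (fun e => glue g (c e) (X e)).
Proof.
move=> cc cX; have cK : computable (fun e => npatterns (logn 2 (c e))).
  exact: computable_npatterns (computable_logn2 cc).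
apply: (computable_sum (F := fun e j => 2 ^ j * gluable g (c e) (X e) j)) => //.
apply: computable_mul (computable_exp (computable_const 2) (computable_var 0)) _.
apply: (computable_exists (P := fun e C =>
      fits g (c (fun i => e i.+1)) (X (fun i => e i.+1)) C
      && yields g (c (fun i => e i.+1)) (e 0) C)).
  apply: computable_exp (computable_const _).
  exact: computable_rename succn cK.
have cc' : computable (fun e => c (fun i => e i.+2)).
  exact: computable_rename (fun i => i.+2) cc.
have ck' := computable_logn2 cc'.
have cpiece s : computable (fun e => @piece g (logn 2 (c (fun i => e i.+2))) (e 0) s).
  apply: computable_digit (computable_const _); last exact: computable_var.
  exact: computable_npatterns.
apply: computable_andb; first apply: computable_andb.
- apply: computable_all => s _; apply: computable_eqn (computable_const 1).
  apply: computable_digit (computable_const 2) _ (cpiece s).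
  exact: computable_rename (fun i => i.+2) cX.
- apply: computable_all => -[[[[s d] a] s'] d'] _.
  apply: computable_lists (computable_const _) _ => //;
  exact: computable_colour.
- apply: computable_all => -[[d s] d'] _.
  by apply: computable_eqn; apply: computable_colour => //; exact: computable_var.
Qed.

Lemma computable_glue_all gs c X : computable c -> computable X ->
  computable (fun e => glue_all gs (c e) (X e)).
Proof.
rewrite /glue_all; elim: gs X => //= g gs IHgs X cc cX.
by apply: (IHgs (fun e => glue g (c e) (X e))) => //; apply: computable_glue.
Qed.

Lemma computable_constant_patterns a c : computable c ->
  computable (fun e => constant_patterns a (c e)).
Proof.
move=> cc; have ck := computable_logn2 cc.
apply: (computable_sum (F := fun e j => 2 ^ j * constant_pattern a (c e) j)).
  exact: computable_npatterns.
apply: computable_mul (computable_exp (computable_const 2) (computable_var 0)) _.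
apply: (computable_exists (P := fun e b =>
    let c' := c (fun i => e i.+1) in lists c' b (enum_rank a) b &&
       all (fun d => colour (logn 2 c') (e 0) d == b) (enum D))).
  exact: computable_rename succn ck.
have cc' : computable (fun e => c (fun i => e i.+2)).
  exact: computable_rename (fun i => i.+2) cc.
apply: computable_andb.
  exact: computable_lists (computable_var 0) (computable_const _) (computable_var 0).
apply: computable_all => d _; apply: computable_eqn (computable_var 0).
exact: computable_colour (computable_logn2 cc') (computable_var 1).
Qed.

Definition has_pattern (X j : nat) : Prop := digit 2 X j = 1.

Lemma characteristic_number K (b : nat -> bool) :
  let x := \sum_(j < K) 2 ^ j * b j in
  x < 2 ^ K /\ forall j, j < K -> has_pattern x j <-> b j.
Proof.
have [|lt_x xE] := @digit_sum 2 K b; first by move=> j _; case: (b j).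
by split=> // j /xE jE; rewrite /has_pattern jE; case: (b j).
Qed.

Lemma has_pattern_gt0 K X : X < 2 ^ K -> 0 < X ->
  exists2 j, j < K & has_pattern X j.
Proof.
elim: K => [|K IHK]; first by case: X.
move=> lt_X X_gt0; have [lt_X'|le_X] := ltnP X (2 ^ K).
  by have [j lt_j jX] := IHK lt_X' X_gt0; exists j => //; apply: ltnW.
exists K => //; rewrite /has_pattern /digit.
have -> // : X %/ 2 ^ K = 1.
apply/eqP; rewrite eqn_leq -ltnS ltn_divLR ?expn_gt0 // leq_divRL ?expn_gt0 //.
by rewrite mul1n -expnS lt_X.
Qed.

Lemma glue_lt g c X : glue g c X < 2 ^ npatterns (logn 2 c).
Proof. by case: (characteristic_number (npatterns (logn 2 c)) (gluable g c X)). Qed.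

Lemma constant_patterns_lt a c : constant_patterns a c < 2 ^ npatterns (logn 2 c).
Proof.
by case: (characteristic_number (npatterns (logn 2 c)) (constant_pattern a c)).
Qed.

Lemma glue_all_lt gs c X : X < 2 ^ npatterns (logn 2 c) ->
  glue_all gs c X < 2 ^ npatterns (logn 2 c).
Proof. by rewrite /glue_all; elim: gs X => //= g gs IHgs X _; apply/IHgs/glue_lt. Qed.

Lemma pattern_exists k (f : D -> nat) : (forall d, f d < k) ->
  exists2 j, j < npatterns k & forall d, colour k j d = f d.
Proof. exact: digits_exist_fin. Qed.

Lemma glueP g (I : domino_instance A) X j : j < npatterns (ncolours I) ->
  has_pattern (glue g (domino_code I) X) j <->
  exists C : copies g -> nat,
    [/\ forall s, C s < npatterns (ncolours I) /\ has_pattern X (C s),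
        forall s d a s' d', seam (s, d, a, s', d') ->
          permits I (colour (ncolours I) (C s) d) a (colour (ncolours I) (C s') d')
      & forall d s d', outlet (d, s, d') ->
          colour (ncolours I) j d = colour (ncolours I) (C s) d'].
Proof.
rewrite -(logn_domino_code I); set c := domino_code I; set k := logn 2 c => lt_j.
have [_ /(_ j lt_j) jE] := characteristic_number (npatterns k) (gluable g c X).
apply: iff_trans jE _; rewrite /gluable -/k.
split=> [|[C [CX Cseam Cout]]].
  case/existsP=> C /andP[/andP[/allP CX /allP Cseam] /allP Cout].
  exists (piece k C); split=> [s|s d a s' d' sm|d s d' ol].
  - split; first exact: (digit_lt (ltn_ord C)).
    by apply/eqP/CX; rewrite mem_enum.
  - by apply/listsP; apply: (Cseam (s, d, a, s', d')); rewrite mem_enum.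
  - by apply/eqP; apply: (Cout (d, s, d')); rewrite mem_enum.
have [|C' ltC' C'E] := @digits_exist_fin (npatterns k) _ C.
  by move=> s; case: (CX s).
have pE s : piece k C' s = C s by exact: C'E.
apply/existsP; exists (Ordinal ltC'); apply/andP; split; first (apply/andP; split).
- by apply/allP => s _ /=; rewrite -/k pE; apply/eqP; case: (CX s).
- apply/allP => -[[[[s d] a] s'] d']; rewrite mem_enum /= => sm.
  by rewrite -/k !pE; apply/listsP; apply: Cseam.
- apply/allP => -[[d s] d']; rewrite mem_enum /= => ol.
  by rewrite -/k pE; apply/eqP/Cout.
Qed.

Lemma constant_patternsP (I : domino_instance A) a j : j < npatterns (ncolours I) ->
  has_pattern (constant_patterns a (domino_code I)) j <->
  exists2 b : nat, permits I b a b & forall d, colour (ncolours I) j d = b.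
Proof.
rewrite -(logn_domino_code I); set c := domino_code I; set k := logn 2 c => lt_j.
have [_ /(_ j lt_j) jE] := characteristic_number (npatterns k) (constant_pattern a c).
apply: iff_trans jE _; rewrite /constant_pattern -/k.
split=> [|[b bP jb]].
  case/existsP=> b /andP[/listsP bP /allP jb]; exists b => // d.
  by apply/eqP/jb; rewrite mem_enum.
have ltb : b < k by case: bP => t _ [<- _ _]; rewrite /k logn_domino_code ltn_ord.
apply/existsP; exists (Ordinal ltb); apply/andP; split; first exact/listsP.
by apply/allP => d _; apply/eqP.
Qed.

(** The orbit of a self-map of a finite set is exhausted in as many steps as the
    set has elements; for sets of patterns this number is computable. *)
Lemma iter_bounded B (F : nat -> nat) x (P : nat -> Prop) :
  (forall y, y < B -> F y < B) -> x < B ->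
  (forall t, t < B -> P (iter t F x)) -> forall t, P (iter t F x).
Proof.
move=> FB xB PB t; pose f (y : 'I_B) := Ordinal (FB y (ltn_ord y)).
pose x' := Ordinal xB; have fE u : iter u F x = iter u f x' :> nat.
  by elim: u => //= u ->.
have con : fconnect f x' (iter t f x') := fconnect_iter f t x'.
rewrite fE -(iter_findex con) -fE; apply: PB.
apply: leq_trans (findex_max con) _; rewrite -[X in _ <= X](card_ord B).
exact: max_card.
Qed.

(** The gluings are the same for all instances; the instance enters through the
    initial set of patterns and the permitted triples. *)
Definition eventually_gluable (a : A) pre per g (I : domino_instance A) : Prop :=
  forall t, 0 < glue g (domino_code I) (iter t (glue_all per (domino_code I))
    (glue_all pre (domino_code I) (constant_patterns a (domino_code I)))).

Lemma gluing_decidable a pre per g (P : domino_instance A -> Prop) :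
  (forall I, P I <-> eventually_gluable a pre per g I) ->
  algorithmically_decidable (@domino_code A) P.
Proof.
move=> PE.
pose x c := glue_all pre c (constant_patterns a c).
pose bad c := [exists t : 'I_(2 ^ npatterns (logn 2 c)),
  glue g c (iter t (glue_all per c) (x c)) == 0].
have [n [h rh hE]] : computable (fun e => 1 - bad (e 0)).
  apply: computable_sub (computable_const 1) _.
  apply: (computable_exists (P := fun e t =>
    glue g (e 0) (iter t (glue_all per (e 0)) (x (e 0))) == 0)).
    apply: computable_exp (computable_const 2) _.
    exact: computable_npatterns (computable_logn2 (computable_var 0)).
  apply: computable_eqn computable_0; apply: computable_glue (computable_var 1) _.
  apply: (computable_iter (F := fun e => glue_all per (e 1))) (computable_var 0) _ _.
    apply: computable_glue_all (computable_var 1) _.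
    exact: computable_constant_patterns (computable_var 1).
  exact: computable_glue_all (computable_var 3) (computable_var 1).
exists (fun v => h [tuple if val i == 0 then thead v else 0 | i < n]); split.
  apply: (@recursive_comp n 1 h (fun i v => if val i == 0 then thead v else 0)) => //.
  by move=> i; case: eqP => _; [exact: recursive_proj|exact: recursive_zero].
move=> I; have /= E := hE (fun i => if i == 0 then domino_code I else 0).
rewrite -[thead _]/(domino_code I) -E.
have -> : bad (domino_code I) = ~~ `[< P I >].
  apply/existsP/asboolPn => [[t /eqP t0] /PE/(_ t)|nP]; first by rewrite -/(x _) t0.
  apply: contra_notP nP => ng; apply/PE.
  apply: (@iter_bounded (2 ^ npatterns (logn 2 (domino_code I))) _ _
    (fun X => 0 < glue g _ X)).
  - by move=> y; exact: glue_all_lt.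
  - exact/glue_all_lt/constant_patterns_lt.
  - move=> t lt_t; rewrite lt0n; apply: contra_notN ng => t0.
    by exists (Ordinal lt_t).
by case: `[< _ >].
Qed.

End Gluing.

(** * Words, rays and orbits *)

Section Words.
Variables (S : finType) (G : selfSimilarGroup S).
Implicit Types (g h : G) (u v w : seq S) (x y : nat -> S) (s : S).

Definition section g u : G := foldl (fun h s => (Phi (h, s)).2) g u.

Fixpoint act_word g u : seq S :=
  if u is s :: u' then (Phi (g, s)).1 :: act_word (Phi (g, s)).2 u' else [::].

Lemma section_cat g u v : section g (u ++ v) = section (section g u) v.
Proof. exact: foldl_cat. Qed.

Lemma act_word_cat g u v :
  act_word g (u ++ v) = act_word g u ++ act_word (section g u) v.
Proof. by elim: u g => //= s u IHu g; rewrite IHu. Qed.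

Lemma section_rcons g u s : section g (rcons u s) = (Phi (section g u, s)).2.
Proof. by rewrite -cats1 section_cat. Qed.

Lemma act_word_rcons g u s :
  act_word g (rcons u s) = rcons (act_word g u) (Phi (section g u, s)).1.
Proof. by rewrite -cats1 act_word_cat cats1. Qed.

Lemma size_act_word g u : size (act_word g u) = size u.
Proof. by elim: u g => //= s u IHu g; rewrite IHu. Qed.

Lemma section1 u : section 1%g u = 1%g.
Proof. by elim: u => //= s u; rewrite Phi_one. Qed.

Lemma act_word1 u : act_word 1%g u = u.
Proof. by elim: u => //= s u IHu; rewrite Phi_one IHu. Qed.

Lemma PhiM g h s :
  Phi ((g * h)%g, s) =
    ((Phi (g, (Phi (h, s)).1)).1, ((Phi (g, (Phi (h, s)).1)).2 * (Phi (h, s)).2)%g).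
Proof.
case Eh: (Phi (h, s)) => [s' h'] /=; case Eg: (Phi (g, s')) => [s'' g'] /=.
exact: Phi_mul Eh Eg.
Qed.

Lemma act_wordM g h u : act_word (g * h)%g u = act_word g (act_word h u).
Proof. by elim: u g h => //= s u IHu g h; rewrite PhiM IHu. Qed.

Lemma act_wordK g : cancel (act_word g) (act_word g^-1%g).
Proof. by move=> u; rewrite -act_wordM mulVg act_word1. Qed.

Fixpoint ray_cat u y : nat -> S :=
  if u is s :: u' then fun n => if n is m.+1 then ray_cat u' y m else s else y.

Definition prefix_of x n : seq S := mkseq x n.
Definition suffix_of x n : nat -> S := fun i => x (n + i).

Lemma size_prefix_of x n : size (prefix_of x n) = n.
Proof. exact: size_mkseq. Qed.

Lemma prefix_of_cons x n : prefix_of x n.+1 = x 0 :: prefix_of (fun i => x i.+1) n.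
Proof. by rewrite /prefix_of /mkseq /= -[1]addn0 iotaDl -map_comp. Qed.

Lemma prefix_ofS x n : prefix_of x n.+1 = rcons (prefix_of x n) (x n).
Proof. exact: mkseqS. Qed.

Lemma prefix_of_ray_cat u y : prefix_of (ray_cat u y) (size u) = u.
Proof.
by elim: u => //= s u IHu; rewrite prefix_of_cons -[in RHS]IHu.
Qed.

Lemma suffix_of_ray_cat u y : suffix_of (ray_cat u y) (size u) = y.
Proof. by elim: u => [|s u IHu] //; apply/funext => i; rewrite -[in RHS]IHu. Qed.

Lemma ray_cat_prefix x n : ray_cat (prefix_of x n) (suffix_of x n) = x.
Proof.
elim: n x => [|n IHn] x //; rewrite prefix_of_cons; apply/funext => -[|i] //=.
by have /(congr1 (fun f => f i)) := IHn (fun i => x i.+1).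
Qed.

Lemma act_ray_cat g u y :
  act g (ray_cat u y) = ray_cat (act_word g u) (act (section g u) y).
Proof.
elim: u g => //= s u IHu g; apply/funext => -[|n] /=; case E: Phi => [t h] //=.
by rewrite -IHu.
Qed.

Lemma act1 y : act (1%g : G) y = y.
Proof.
by apply/funext => n; elim: n y => [|n IHn] y /=; rewrite Phi_one ?IHn.
Qed.

Lemma prefix_of_act g x n : prefix_of (act g x) n = act_word g (prefix_of x n).
Proof.
have := prefix_of_ray_cat (act_word g (prefix_of x n))
  (act (section g (prefix_of x n)) (suffix_of x n)).
by rewrite size_act_word size_prefix_of -act_ray_cat ray_cat_prefix.
Qed.

Lemma suffix_of_act g x n :
  suffix_of (act g x) n = act (section g (prefix_of x n)) (suffix_of x n).
Proof.
have := suffix_of_ray_cat (act_word g (prefix_of x n))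
  (act (section g (prefix_of x n)) (suffix_of x n)).
by rewrite size_act_word size_prefix_of -act_ray_cat ray_cat_prefix.
Qed.

Lemma prefix_of_inj x y :
  (forall n, exists2 m, n <= m & prefix_of x m = prefix_of y m) -> x = y.
Proof.
move=> E; apply/funext => n; have [m lt_m] := E n.+1.
by move/(congr1 (nth (x 0) ^~ n)); rewrite !nth_mkseq.
Qed.

Variable xi : nat -> S.

Definition orbit_word u : Prop := exists g, act_word g (prefix_of xi (size u)) = u.

Lemma orbit_word_nil : orbit_word [::].
Proof. by exists 1%g. Qed.

Lemma orbit_word_prefix u v : orbit_word (u ++ v) -> orbit_word u.
Proof.
move=> [g]; rewrite size_cat /prefix_of /mkseq iotaD map_cat act_word_cat => E.
exists g; move/(congr1 (take (size u))): E.
by rewrite !take_size_cat // size_act_word size_map size_iota.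
Qed.

Lemma orbit_word_rcons u s : orbit_word (rcons u s) -> orbit_word u.
Proof. by rewrite -cats1; exact: orbit_word_prefix. Qed.

Lemma orbit_word_act g u : orbit_word (act_word g u) <-> orbit_word u.
Proof.
split=> -[h hE]; rewrite ?size_act_word in hE.
  by exists (g^-1 * h)%g; rewrite act_wordM hE act_wordK.
by exists (g * h)%g; rewrite act_wordM size_act_word hE.
Qed.

(** An element carrying [a ++ u] to [a ++ v] has a section carrying [u] to [v]:
    the orbit relation passes to suffixes. *)
Lemma orbit_word_suffix a u v : size u = size v ->
  orbit_word (a ++ u) -> orbit_word (a ++ v) -> exists g, act_word g u = v.
Proof.
move=> suv [g gE] [h hE]; rewrite !size_cat suv in gE hE.
have E : act_word (h * g^-1)%g (a ++ u) = a ++ v by rewrite act_wordM -gE act_wordK.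
exists (section (h * g^-1)%g a); move: E; rewrite act_word_cat.
move/(congr1 (drop (size a))).
by rewrite !drop_size_cat // size_act_word.
Qed.

Lemma ray_orbit_act g x : ray_orbit G xi (act g x) <-> ray_orbit G xi x.
Proof.
split=> -[h _ hE]; first by exists (g^-1 * h)%g; rewrite // -actM hE actM mulVg act1.
by exists (g * h)%g; rewrite // -actM hE.
Qed.

Lemma orbit_word_prefix_of x n : ray_orbit G xi x -> orbit_word (prefix_of x n).
Proof.
by move=> [g _ <-]; exists g; rewrite size_prefix_of prefix_of_act.
Qed.

Lemma orbit_wordP u : orbit_word u <-> exists y, ray_orbit G xi (ray_cat u y).
Proof.
split=> [[g gE]|[y /(orbit_word_prefix_of (size u))]]; last first.
  by rewrite prefix_of_ray_cat.
exists (suffix_of (act g xi) (size u)); exists g => //.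
by rewrite -{1}gE -prefix_of_act ray_cat_prefix.
Qed.

(** A continuation of a word is chosen from the set [A] of the admissible ones.
    The choice depends on the set alone, hence is the same at both ends of every
    edge along which the admissible set is constant; and it is [t] wherever [t]
    is admissible. *)
Definition favourite (T : choiceType) (t0 t : T) (A : set T) : T :=
  if `[< A t >] then t else xget t0 A.

Lemma favouriteP (T : choiceType) (t0 t : T) (A : set T) :
  (exists z, A z) -> A (favourite t0 t A).
Proof.
by case=> z Az; rewrite /favourite; case: asboolP => // _; apply: xgetI Az.
Qed.

Lemma favourite_id (T : choiceType) (t0 t : T) (A : set T) :
  A t -> favourite t0 t A = t.
Proof. by move=> At; rewrite /favourite asboolT. Qed.

End Words.

(** * The boundary of the finite pieces *)

Section Boundary.
Variables (S : finType) (G : selfSimilarGroup S).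
Implicit Types (g h : G) (u v : seq S) (s : S) (N : {fset G}).

Lemma nucleus1 N s : is_nucleus N -> 1%g \in N.
Proof.
case=> -[_ absN] _; have [] := absN (fun=> (1%g, s, s, 1%g)).
  by split=> // i; exact: Phi_one.
by move=> n /(_ n (leqnn n)).
Qed.

Lemma nucleus_section N g u : is_nucleus N -> g \in N -> section g u \in N.
Proof.
case=> -[subN _] _; elim: u g => //= s u IHu g gN; apply: IHu.
apply: (subN (g, s, (Phi (g, s)).1, (Phi (g, s)).2)) gN.
by rewrite /is_transition /source /input /output /target /=; case: Phi.
Qed.

(** By minimality: a state without predecessor could be dropped. *)
Lemma nucleus_predecessor N g : is_nucleus N -> g \in N ->
  exists e : transition G, [/\ is_transition e, source e \in N & target e = g].
Proof.
move=> [[subN absN] minN] gN; apply: contrapT => nopred.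
have targetNg (e : transition G) :
    is_transition e -> source e \in N -> target e \in (N `\ g)%fset.
  move=> te eN; rewrite !inE subN // andbT; apply/eqP => eg.
  by apply: nopred; exists e.
suff /minN/fsubsetP/(_ g gN) : absorbing (N `\ g)%fset by rewrite !inE eqxx.
split=> [e te|p rp].
  by move=> eNg; apply: (targetNg _ te); move: eNg; rewrite !inE => /andP[].
have [n nP] := absN p rp; exists n.+1 => -[|i] // lt_ni.
by case: rp => tp ->; apply: (targetNg _ (tp i)); apply: nP.
Qed.

(** An index stands for a singular left-infinite path of the nucleus: [prev]
    drops the last transition of the path, [letter false] and [letter true] are
    the input and the output of the last transition and [final] is its target. *)
Record boundary N := Boundary {
  index : finType;
  prev : index -> index;
  letter : bool -> index -> S;
  final : index -> G;
  final_in : forall i, final i \in N;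
  final_neq1 : forall i, final i <> 1%g;
  boundary_step : forall i,
    Phi (final (prev i), letter false i) = (letter true i, final i);
}.

Section BoundaryWords.
Variables (N : {fset G}) (bd : boundary N).
Implicit Types (i : index bd).

(** The source of the last [n] transitions of the path. *)
Definition initial n i : G := final (iter n (@prev N bd) i).

(** The input or output read along the last [n] transitions of the path. *)
Fixpoint word n i (b : bool) : seq S :=
  if n is m.+1 then rcons (word m (prev i) b) (letter b i) else [::].

Lemma wordS n i b : word n.+1 i b = rcons (word n (prev i) b) (letter b i).
Proof. by []. Qed.

Lemma size_word n i b : size (word n i b) = n.
Proof. by elim: n i => //= n IHn i; rewrite size_rcons IHn. Qed.

Lemma initialS n i : initial n.+1 i = initial n (prev i).
Proof. by rewrite /initial iterSr. Qed.

Lemma section_word n i : section (initial n i) (word n i false) = final i.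
Proof.
elim: n i => //= n IHn i; rewrite initialS section_rcons IHn.
by rewrite boundary_step.
Qed.

Lemma act_word_word n i : act_word (initial n i) (word n i false) = word n i true.
Proof.
elim: n i => //= n IHn i; rewrite initialS act_word_rcons IHn section_word.
by rewrite boundary_step.
Qed.

Lemma word_cat n m i b :
  word (m + n) i b = word m (iter n (@prev N bd) i) b ++ word n i b.
Proof.
elim: n i => [|n IHn] i; first by rewrite addn0 cats0.
by rewrite addnS iterSr -[RHS]rcons_cat -IHn.
Qed.

End BoundaryWords.

Definition exhaustive N (bd : boundary N) : Prop :=
  forall g u, g \in N -> section g u <> 1%g ->
  exists i : index bd, initial (size u) i = g /\ word (size u) i false = u.

(** States of the nucleus have predecessors, so a finite path to a non-trivial
    state extends to a left-infinite one, which is one of the finitely many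
    singular paths.  Dropping the last transition of a singular path gives a
    singular path because the trivial state has only trivial successors. *)
Lemma boundary_exists N : post_critically_finite G -> is_nucleus N ->
  exists bd : boundary N, exhaustive bd.
Proof.
move=> [_ pcf] nN; have /finite_seqP[l lE] := pcf N nN.
have lP (p : nat -> transition G) : p \in l <-> singular_left_paths N p by rewrite lE.
pose drop1 (p : nat -> transition G) i := p i.+1.
have dropP (p : seq_sub l) : drop1 (val p) \in l.
  have /lP[[tp pp] pN p1] := valP p; apply/lP; split; rewrite /drop1 //.
  rewrite pp => E; apply: p1; have := tp 0; rewrite /is_transition E Phi_one.
  by case.
have finP (p : seq_sub l) : target (val p 0) \in N.
  by have /lP[_ pN _] := valP p; case: (pN 0).
have finP1 (p : seq_sub l) : target (val p 0) <> 1%g.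
  by have /lP[] := valP p.
have stepP (p : seq_sub l) :
    Phi (target (val p 1), input (val p 0)) = (output (val p 0), target (val p 0)).
  by have /lP[[tp pp] _ _] := valP p; rewrite pp; exact: tp.
pose bd := @Boundary N (seq_sub l) (fun p => SeqSub (dropP p))
  (fun b p => if b then output (val p 0) else input (val p 0))
  (fun p => target (val p 0)) finP finP1 stepP.
exists bd => g u gN; elim/last_ind: u => [|u s IHu] nontriv.
  (* A left-infinite path to [g] is built from predecessors. *)
  have [e0 _] := nucleus_predecessor nN gN.
  have /choice[e eP] h : exists e, h \in N ->
      [/\ is_transition e, source e \in N & target e = h].
    case hN: (h \in N); last by exists e0.
    by have [e eP] := nucleus_predecessor nN hN; exists e.
  pose p i := e (iter i (fun h => source (e h)) g).
  have itN i : iter i (fun h => source (e h)) g \in N.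
    by elim: i => //= i /eP[].
  have pl : p \in l.
    apply/lP; split.
        split=> i; first by case: (eP _ (itN i)).
        by case: (eP _ (itN i.+1)).
      by move=> i; case: (eP _ (itN i)) => _ pN ->; rewrite pN itN.
    by case: (eP _ (itN 0)) => _ _ -> /=; exact: nontriv.
  by exists (SeqSub pl); case: (eP _ (itN 0)).
(* The path through [u] is one transition longer than the path [i] given by
   induction. *)
have nontriv_u : section g u <> 1%g.
  by move=> E; apply: nontriv; rewrite section_rcons E Phi_one.
have [i [ig iu]] := IHu nontriv_u.
have iE : target (val i 0) = section g u.
  by rewrite -[LHS](section_word (size u) i) ig iu.
pose e : transition G :=
  (section g u, s, (Phi (section g u, s)).1, section g (rcons u s)).
have te : is_transition e.
  rewrite /is_transition /source /input /output /target /e /= section_rcons.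
  by case: Phi.
pose p n := if n is m.+1 then val i m else e.
have pl : p \in l.
  have /lP[[ti pi] iN i1] := valP i; apply/lP; split=> [|[|n]|].
  - by split=> -[|n]; [exact: te|exact: ti|exact: iE|exact: pi].
  - by split; exact: nucleus_section.
  - exact: iN.
  - exact: nontriv.
exists (SeqSub pl).
have -> : size (rcons u s) = (size u).+1 by rewrite size_rcons.
have prevE : prev (SeqSub pl : index bd) = i by apply: val_inj.
by rewrite initialS wordS prevE ig iu.
Qed.

End Boundary.

(** * Eventual periodicity *)

Lemma iter_ultimately_periodic (T : finType) (f : T -> T) :
  exists M L, 0 < L /\ forall x, iter (M + L) f x = iter M f x.
Proof.
pose F (n : 'I_(#|{ffun T -> T}|.+1)) : {ffun T -> T} := [ffun x => iter n f x].
have : ~~ injectiveb F.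
  by apply/negP => /injectiveP/leq_card; rewrite card_ord ltnn.
move=> /injectivePn[m [n neq_mn FE]].
wlog lt_mn : m n neq_mn FE / m < n.
  move=> wl; case: (ltngtP m n) => [||E]; [exact: wl| |].
    by apply: wl; rewrite 1?eq_sym.
  by case/eqP: neq_mn; apply: val_inj.
exists m, (n - m); split=> [|x]; first by rewrite subn_gt0.
by rewrite subnKC 1?ltnW //; move/ffunP/(_ x): FE; rewrite !ffunE.
Qed.

Definition ultimately_periodic (L : nat) (P : nat -> Prop) : Prop :=
  exists n0, forall n, n0 <= n -> P n <-> P (n + L).

Lemma ultimately_periodic_shift L P :
  ultimately_periodic L (fun n => P n.+1) -> ultimately_periodic L P.
Proof. by case=> n0 n0P; exists n0.+1 => -[|n] // /n0P; rewrite addSn. Qed.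

Lemma ultimately_periodic_fin (T : finType) L (P : T -> nat -> Prop) :
  (forall x, ultimately_periodic L (P x)) ->
  exists n0, forall x n, n0 <= n -> P x n <-> P x (n + L).
Proof.
move=> /choice[w wP]; exists (\max_x w x) => x n le_n; apply: wP.
exact: leq_trans (leq_bigmax x) le_n.
Qed.

(** By hypothesis the intersection of the set with a residue class modulo [L] is
    finite or the whole class. *)
Lemma recurrent_ultimately_periodic L (P : nat -> Prop) : 0 < L ->
  (forall n, (forall q0, exists2 q, q0 <= q & P (n + q * L)) -> P n) ->
  ultimately_periodic L P.
Proof.
move=> L_gt0 rec; pose inf n := forall q0, exists2 q, q0 <= q & P (n + q * L).
have infL n q : inf (n + q * L) <-> inf n.
  split=> infn q0.
    have [q' le_q' Pq'] := infn q0; exists (q + q'); first by lia.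
    by rewrite mulnDl addnA.
  have [q' le_q' Pq'] := infn (q0 + q); exists (q' - q); first by lia.
  by have -> : n + q * L + (q' - q) * L = n + q' * L by nia.
have /choice[w wP] (r : 'I_L) : exists w, inf r \/ forall q, w <= q -> ~ P (r + q * L).
  have [|ninf] := pselect (inf r); first by exists 0; left.
  move/existsNP: ninf => [w wP]; exists w; right=> q le_q Pq.
  by apply: wP; exists q.
pose b := \max_r w r; have key n : b * L <= n -> P n <-> inf n.
  move=> le_n; split=> [Pn|]; last exact: rec.
  pose r := Ordinal (ltn_pmod n L_gt0).
  have nE : n = r + n %/ L * L by rewrite {1}(divn_eq n L) addnC.
  have [] := wP r; first by rewrite [in inf n]nE infL.
  move=> /(_ (n %/ L)); rewrite -nE; case=> //.
  by apply: leq_trans (leq_bigmax r) _; rewrite leq_divRL.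
exists (b * L) => n le_n; rewrite !key //; last by lia.
by have := infL n 1; rewrite mul1n => ->.
Qed.

Section OrbitPeriodicity.
Variables (S : finType) (G : selfSimilarGroup S) (N : {fset G}) (bd : boundary N).
Variables (xi : nat -> S) (M L : nat).
Hypothesis prevML :
  forall i, iter (M + L) (@prev _ _ _ bd) i = iter M (@prev _ _ _ bd) i.
Notation prev := (@prev _ _ _ bd).
Notation orbit_word := (@orbit_word S G xi).

Lemma initial_periodic n (i : index bd) :
  M <= n -> initial (n + L) i = initial n i :> G.
Proof.
move=> le_M; rewrite /initial; congr final.
have -> : n + L = (M + L) + (n - M) by lia.
by rewrite iterD prevML -iterD; congr (iter _ _ _); lia.
Qed.

Hypothesis L_gt0 : 0 < L.

(** If [n] and [n'] are congruent modulo the period, the shorter of [word n i b]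
    and [word n' i b] is both a prefix and a suffix of the longer.  As a prefix
    of a much longer word of the orbit, [word n i b] may be continued by a piece
    [y] of the periodic word; so may [word n' i b], for some [n' >= n] for which
    [u] is another continuation.  Passing to the suffix [word n i b], a section
    exchanges [y] and [u]. *)
Lemma orbit_word_recurrent (i : index bd) b u n : iter L prev i = i ->
  (forall q0, exists2 q, q0 <= q & orbit_word (word (n + q * L) i b ++ u)) ->
  orbit_word (word n i b ++ u).
Proof.
move=> iL inf; have iqL q : iter (q * L) prev i = i.
  by elim: q => //= q IHq; rewrite mulSn iterD IHq.
have wE m q : word (m + q * L) i b = word m i b ++ word (q * L) i b.
  by rewrite word_cat iqL.
have [q1 _ O1] := inf 0; have [q2 le_q O2] := inf (q1 + size u).
pose z := word ((q2 - q1) * L) i b; pose y := take (size u) z.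
have size_y : size u = size y.
  rewrite size_take size_word; case: ltnP => // le_z.
  by apply/eqP; rewrite eqn_leq le_z andbT; nia.
have zE : z = y ++ drop (size u) z by rewrite cat_take_drop.
have W2 : word (n + q2 * L) i b = word (n + q1 * L) i b ++ z.
  by rewrite -wE; congr (word _ i b); nia.
have W2' : word (n + q2 * L) i b = word n i b ++ z ++ word (q1 * L) i b.
  by rewrite catA -!wE; congr (word _ i b); nia.
have Oy1 : orbit_word (word (n + q1 * L) i b ++ y).
  by move: O2; rewrite W2 zE catA -catA; exact: orbit_word_prefix.
have Oy : orbit_word (word n i b ++ y).
  by move: O2; rewrite W2' zE -!catA catA; exact: orbit_word_prefix.
have suffixE v : word (n + q1 * L) i b ++ v =
    word (q1 * L) (iter n prev i) b ++ (word n i b ++ v).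
  by rewrite addnC word_cat catA.
rewrite !suffixE in O1 Oy1.
have [g gE] : exists g : G, act_word g (word n i b ++ y) = word n i b ++ u.
  have size_eq : size (word n i b ++ y) = size (word n i b ++ u).
    by rewrite !size_cat size_y.
  exact: orbit_word_suffix size_eq Oy1 O1.
by rewrite -gE; apply/orbit_word_act.
Qed.

(** Dropping transitions reduces the claim to a recurring path, at the price of
    longer words [u]. *)
Lemma orbit_word_ultimately_periodic (i : index bd) b u :
  ultimately_periodic L (fun n => orbit_word (word n i b ++ u)).
Proof.
have main m (i' : index bd) u' : iter L prev (iter m prev i') = iter m prev i' ->
    ultimately_periodic L (fun n => orbit_word (word n i' b ++ u')).
  elim: m i' u' => [|m IHm] i' u' i'L.
    by apply: recurrent_ultimately_periodic => // n; exact: orbit_word_recurrent.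
  apply: ultimately_periodic_shift.
  have := IHm (prev i') (letter b i' :: u'); rewrite -iterSr => /(_ i'L).
  by case=> n0 n0P; exists n0 => n /n0P; rewrite /= !cat_rcons.
by apply: (main M); rewrite -iterD addnC.
Qed.

End OrbitPeriodicity.

(** * Solutions on the finite pieces *)

Section Levels.
Variables (S : finType) (G : selfSimilarGroup S) (N : {fset G}) (bd : boundary N).
Variables (xi : nat -> S) (I : domino_instance N).
Hypothesis full : exhaustive bd.
Notation k := (ncolours I).
Notation orbit_word := (@orbit_word S G xi).
Notation position := (index bd * bool)%type.
Implicit Types (u : seq S) (s : S) (a : N) (i : index bd) (c : seq S -> 'I_k).

Lemma permits_ord (x y : 'I_k) a :
  permits I x a y <-> (x, a, y) \in allowed I.
Proof.
split=> [[[[x' a'] y'] inI /= [/val_inj <- <- /val_inj <-]] //|inI].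
by exists (x, a, y).
Qed.

(** A transition to the trivial state fixes the tail, so that it gives an edge of
    the Schreier graph whatever the tail is. *)
Definition solves n c : Prop :=
  forall a u, size u = n -> orbit_word u -> section (val a) u = 1%g ->
    (c u, a, c (act_word (val a) u)) \in allowed I.

(** The colours of positions whose word is not in the orbit are left free. *)
Definition restricts_to n c (j : nat) : Prop :=
  forall i b, orbit_word (word n i b) ->
    colour k j ((i, b) : position) = c (word n i b).

Definition boundary_pattern n j : Prop := exists2 c, solves n c & restricts_to n c j.

Lemma orbit_word_extend u : orbit_word u -> exists s, orbit_word (rcons u s).
Proof.
move/orbit_wordP => [y /(orbit_word_prefix_of (size u).+1)] O.
exists (y 0); move: O; rewrite prefix_ofS prefix_of_ray_cat.
have /(congr1 (fun f => f 0)) := suffix_of_ray_cat u y.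
by rewrite /suffix_of addn0 => ->.
Qed.

(** The transition from [u s] to [u' s'], where the section at [u] is not
    trivial: the pair of the state and [u] is then a boundary index [i]. *)
Definition seam_between n (t : S * position * N * S * position) : Prop :=
  let: (s, (i, b), a, s', (i', b')) := t in
  [/\ i' = i, b = false & b' = true] /\
  [/\ val a = initial n i, Phi (final i, s) = (s', 1%g)
    & orbit_word (rcons (word n i false) s)].

Definition outlet_from n (t : position * S * position) : Prop :=
  let: ((i, b), s, (i', b')) := t in
  [/\ i' = prev i, b' = b, s = letter b i & orbit_word (word n.+1 i b)].

Definition level_gluing n : gluing position N :=
  Gluing (fun t => `[< seam_between n t >]) (fun t => `[< outlet_from n t >]).

Lemma favourite_letter s0 s u v :
  (forall t, orbit_word (rcons u t) <-> orbit_word (rcons v t)) ->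
  favourite s0 s [set t | orbit_word (rcons u t)] =
  favourite s0 s [set t | orbit_word (rcons v t)].
Proof. by move=> E; congr favourite; apply/seteqP; split=> t /= /E. Qed.

(** A solution for [n.+1] is restricted to the copy of [s] by appending [s] where
    that gives a word of the orbit, and another letter elsewhere; the copies need
    solutions on all words of the orbit.  Conversely solutions on the copies are
    assembled, and the transitions that are not yet trivial after [n] letters are
    those of the boundary. *)
Lemma boundary_patternS n j : boundary_pattern n.+1 j <->
  exists C : S -> nat,
    [/\ forall s, C s < npatterns position k /\ boundary_pattern n (C s),
        forall s d a s' d', seam_between n (s, d, a, s', d') ->
          permits I (colour k (C s) d) a (colour k (C s') d')
      & forall d s d', outlet_from n (d, s, d') -> colour k j d = colour k (C s) d'].
Proof.
split=> [[c csol cj]|[C [CP Cseam Cout]]].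
  pose tail s u := favourite (xi 0) s [set t | orbit_word (rcons u t)].
  pose c_ s u := c (rcons u (tail s u)).
  have c_E s u : orbit_word (rcons u s) -> c_ s u = c (rcons u s).
    by move=> us; rewrite /c_ /tail favourite_id.
  have /choice[C CP] s : exists C, C < npatterns position k /\
      forall d : position, colour k C d = c_ s (word n d.1 d.2).
    have [|C ltC CE] :=
      @pattern_exists position k (fun d => c_ s (word n d.1 d.2)) => //.
    by exists C.
  exists C; split=> [s|s [i b] a s' [i' b']|[i b] s [i' b']].
  - have [ltC CE] := CP s; split=> //; exists (c_ s) => [a u su Ou au|i b _].
      have tailE t : act_word (val a) (rcons u t) = rcons (act_word (val a) u) t.
        by rewrite act_word_rcons au Phi_one.
      rewrite /c_ [tail s (act_word _ _)](@favourite_letter _ _ _ u) => [|t].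
        rewrite -tailE; apply: csol; first by rewrite size_rcons su.
          apply: (favouriteP _ _ (A := [set t | orbit_word (rcons u t)])).
          exact: orbit_word_extend.
        by rewrite section_rcons au Phi_one.
      by rewrite -tailE; exact: orbit_word_act.
    exact: CE.
  - move=> [[-> -> ->] [ai Phis Os]].
    rewrite (CP s).2 (CP s').2 /= !c_E //; last first.
      have := act_word_rcons (val a) (word n i false) s.
      rewrite ai section_word Phis act_word_word => <-.
      exact/orbit_word_act.
    apply/permits_ord.
    have -> : rcons (word n i true) s' = act_word (val a) (rcons (word n i false) s).
      by rewrite act_word_rcons ai section_word Phis act_word_word.
    apply: csol => //; first by rewrite size_rcons size_word.
    by rewrite section_rcons ai section_word Phis.
  - move=> [-> -> -> O]; rewrite cj // (CP (letter b i)).2 /= c_E //.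
have /choice[c_ c_P] s : exists c, solves n c /\ restricts_to n c (C s).
  by have [_ [c cs cr]] := CP s; exists c.
pose c u := c_ (last (xi 0) u) (take (size u).-1 u).
have cE u s : c (rcons u s) = c_ s u.
  by rewrite /c last_rcons size_rcons /= -cats1 take_size_cat.
exists c => [a|i b O]; last first.
  rewrite (Cout (i, b) (letter b i) (prev i, b)) // cE.
  by have [_ ->] := c_P (letter b i) => //; exact: orbit_word_rcons O.
elim/last_ind=> // u s _; rewrite size_rcons => -[su] O; have Ou := orbit_word_rcons O.
rewrite section_rcons act_word_rcons !cE; set h := section _ _ => hs.
have [h1|h_neq1] := eqVneq h 1%g.
  by rewrite h1 Phi_one; have [] := c_P s => csol _; apply: csol.
have [|i [ai iu]] := full (valP a) (u := u); first exact/eqP.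
rewrite su in ai iu.
have hi : h = final i by rewrite /h -ai -iu section_word.
have [_ cr] := c_P s; have [_ cr'] := c_P (Phi (h, s)).1.
have O1 : orbit_word (word n i false) by rewrite iu.
have O2 : orbit_word (word n i true) by rewrite -act_word_word; apply/orbit_word_act.
have sm : seam_between n (s, (i, false), a, (Phi (h, s)).1, (i, true)).
  by split=> //; split; rewrite ?ai ?iu // -hi -hs; case: Phi.
have := Cseam _ _ _ _ _ sm; rewrite cr // cr' // => /permits_ord.
by rewrite iu -act_word_word ai iu.
Qed.

Lemma boundary_pattern0 one j : val one = 1%g :> G ->
  boundary_pattern 0 j <->
  exists2 b, permits I b one b & forall d : position, colour k j d = b.
Proof.
move=> one1; split=> [[c csol cj]|[b bP jb]].
  exists (c [::]) => [|[i b]]; last exact: (cj i b (orbit_word_nil _ _)).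
  by apply/permits_ord; apply: (csol one [::]) => //; exact: orbit_word_nil.
have ltb : b < k by case: bP => t _ [<- _ _]; exact: ltn_ord.
exists (fun=> Ordinal ltb) => [a u su _ a1|i b' _]; last exact: jb.
have -> : a = one by apply: val_inj; rewrite one1 -a1 (size0nil su).
exact/permits_ord.
Qed.

End Levels.

Local Open Scope classical_set_scope.

(** * Singular rays and the whole graph *)

(** Compactness: the limit of a sequence of colourings along an ultrafilter
    satisfies every local condition that they ultimately satisfy. *)
Lemma limit_colouring (V : Type) k (tau : nat -> V -> 'I_k) :
  exists sigma : V -> 'I_k, forall x y (P : 'I_k -> 'I_k -> Prop),
    (exists n, forall t, n <= t -> P (tau t x) (tau t y)) -> P (sigma x) (sigma y).
Proof.
have [U [ultraU leU]] := @ultraFilterLemma nat eventually _.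
have properU : ProperFilter U by exact: ultra_proper.
have /choice[sigma sigmaP] x : exists c, U [set t | tau t x = c].
  apply: contrapT => /forallNP noc.
  have avoid (s : seq 'I_k) : U [set t | tau t x \notin s].
    elim: s => [|c s IHs]; first by apply: filterS filterT.
    have [/noc //|Uc] := in_ultra_setVsetC [set t | tau t x = c] ultraU.
    apply: filterS (filterI IHs Uc) => t /= [ts tc].
    by rewrite inE negb_or ts andbT; apply/eqP.
  by have [t /=] := filter_ex (avoid (enum 'I_k)); rewrite mem_enum.
exists sigma => x y P [n nP].
have Un : U [set t | n <= t] by apply: leU; exists n.
have [t /= [[le_n <-] <-]] := filter_ex (filterI (filterI Un (sigmaP x)) (sigmaP y)).
exact: nP.
Qed.

Lemma infinitely_often (T : finType) (f : nat -> T) :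
  exists x, forall n, exists2 m, n <= m & f m = x.
Proof.
apply: contrapT => /forallNP no.
have /choice[w wP] x : exists n, forall m, n <= m -> f m <> x.
  have /existsNP[n nP] := no x; exists n => m le_m fm.
  by apply: nP; exists m.
exact: (wP _ _ (leq_bigmax (f (\max_x w x)))).
Qed.

Section SingularRays.
Variables (S : finType) (G : selfSimilarGroup S) (N : {fset G}) (bd : boundary N).
Variables (xi : nat -> S) (M L : nat).
Hypothesis L_gt0 : 0 < L.
Hypothesis prevML :
  forall i, iter (M + L) (@prev _ _ _ bd) i = iter M (@prev _ _ _ bd) i.
Hypothesis full : exhaustive bd.
Notation prev := (@prev _ _ _ bd).
Notation position := (index bd * bool)%type.
Implicit Types (i : index bd) (x y : nat -> S).

Definition recurring i : Prop := iter L prev i = i.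

Lemma iter_recurring i q : recurring i -> iter (q * L) prev i = i.
Proof. by move=> iL; elim: q => //= q IHq; rewrite mulSn iterD IHq. Qed.

(** On recurring indices [prev] is a permutation of order dividing [L], and this
    is the [n]-th power of its inverse. *)
Definition next n i : index bd := iter (n * L.-1) prev i.

Lemma prev_next n i : recurring i -> prev (next n.+1 i) = next n i.
Proof.
move=> iL; rewrite /next -iterS.
have -> : (n.+1 * L.-1).+1 = n * L.-1 + 1 * L by nia.
by rewrite iterD iter_recurring.
Qed.

Lemma iter_prev_next n i : recurring i -> iter n prev (next n i) = i.
Proof.
move=> iL; rewrite /next -iterD.
have -> : n + n * L.-1 = n * L by nia.
exact: iter_recurring.
Qed.

Lemma next_mul q n i : recurring i -> next (q * L + n) i = next n i.
Proof.
move=> iL; rewrite /next.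
have -> : (q * L + n) * L.-1 = n * L.-1 + (q * L.-1) * L by nia.
by rewrite iterD iter_recurring.
Qed.

(** A recurring index determines a two-sided periodic path of non-trivial states;
    its right half reads this ray. *)
Definition singular_ray (d : position) : nat -> S :=
  fun n => letter d.2 (next n.+1 d.1).

Lemma prefix_singular_ray i b n : recurring i ->
  prefix_of (singular_ray (i, b)) n = word n (next n i) b.
Proof.
move=> iL; elim: n => [|n IHn]; first by [].
by rewrite prefix_ofS IHn wordS prev_next.
Qed.

Lemma prefix_singular_ray_mul i b q : recurring i ->
  prefix_of (singular_ray (i, b)) (q * L) = word (q * L) i b.
Proof.
by move=> iL; rewrite prefix_singular_ray // -[q * L]addn0 next_mul.
Qed.

Lemma suffix_singular_ray i b q : recurring i ->
  suffix_of (singular_ray (i, b)) (q * L) = singular_ray (i, b).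
Proof.
by move=> iL; apply/funext => n; rewrite /suffix_of /singular_ray /= -addnS next_mul.
Qed.

Lemma act_singular_ray i : recurring i ->
  act (final i) (singular_ray (i, false)) = singular_ray (i, true).
Proof.
move=> iL; apply: prefix_of_inj => n; exists n => //.
rewrite prefix_of_act !prefix_singular_ray // -act_word_word.
by rewrite /initial iter_prev_next.
Qed.

(** Each prefix of [x] is read along a singular path, and dropping at least [M]
    transitions from that path leads to recurring indices.  By the pigeonhole
    principle one recurring index is reached for infinitely many prefixes, and
    these determine [x]. *)
Lemma singular_edge (g : G) x : g \in N ->
  (forall n, section g (prefix_of x n) <> 1%g) ->
  exists i, [/\ recurring i, final i = g & x = singular_ray (i, false)].
Proof.
move=> gN sing.
have /choice[w wP] n : exists i : index bd, initial (n + M) i = g /\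
    word (n + M) i false = prefix_of x (n + M).
  by have := full gN (sing (n + M)); rewrite size_prefix_of.
have recM n i : recurring (iter (n + M) prev i).
  by rewrite /recurring -iterD addnCA iterD [L + M]addnC prevML -iterD.
have [i iP] := infinitely_often (fun n => iter (n + M) prev (w n)).
have iL : recurring i by have [n _ <-] := iP 0; exact: recM.
exists i; split=> //; first by have [n _ <-] := iP 0; case: (wP n).
apply: prefix_of_inj => n; have [m le_m wm] := iP n; exists m => //.
rewrite prefix_singular_ray // -wm /next -iterD.
have -> : m * L.-1 + (m + M) = m * L + M by nia.
rewrite iterD iter_recurring; last by rewrite -[M]add0n; exact: recM.
have [_] := wP m; move/(congr1 (take m)).
rewrite word_cat take_size_cat ?size_word // => ->.
by rewrite /prefix_of /mkseq -map_take take_iota; congr map; congr iota; lia.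
Qed.

End SingularRays.

(** * Decidability *)

Section Closing.
Variables (S : finType) (G : selfSimilarGroup S) (N : {fset G}) (bd : boundary N).
Variables (xi : nat -> S) (M L : nat) (I : domino_instance N).
Hypothesis L_gt0 : 0 < L.
Hypothesis prevML :
  forall i, iter (M + L) (@prev _ _ _ bd) i = iter M (@prev _ _ _ bd) i.
Hypothesis full : exhaustive bd.
Notation k := (ncolours I).
Notation position := (index bd * bool)%type.
Notation ray d := (@singular_ray S G N bd L d).
Notation orbit := (@ray_orbit S G xi).
Implicit Types (i : index bd) (x y : nat -> S) (a : N).

Lemma solvableE : domino_solvable (schreier_graph N xi) I <->
  exists tau : (nat -> S) -> 'I_k, forall a x, orbit x ->
    (tau x, a, tau (act (val a) x)) \in allowed I.
Proof.
have xiO : xi \in orbit by apply: mem_set; exists 1%g; rewrite ?act1.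
pose v0 : orbit := exist _ xi xiO.
split=> [[tau tauP]|[tau tauP]]; last first.
  by exists (fun v => tau (val v)) => -[a v]; apply: tauP; exact: set_mem (valP v).
exists (fun x => tau (insubd v0 x)) => a x /mem_set Ox.
have insubE y (Oy : y \in orbit) : insubd v0 y = exist _ y Oy.
  by apply: val_inj; rewrite val_insubd Oy.
rewrite insubE (insubE _ (act_ray_orbit (val a) (exist _ x Ox))).
exact: (tauP (a, exist _ x Ox)).
Qed.

(** Rays are grouped by their tail after [n] letters, where [n] is a multiple of
    the period.  The class of a tail depends on the ray alone, as different
    indices may give the same singular ray.  The class [None] of the other tails
    is subject to no condition, but it requires that patterns exist. *)
Definition tail_class y : option position := [pick d | `[< ray d = y >]].

Definition tail_ray (s : option position) : nat -> S := oapp (fun d => ray d) xi s.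

Lemma tail_classK d : tail_ray (tail_class (ray d)) = ray d.
Proof.
by rewrite /tail_class; case: pickP => [e /asboolP|/(_ d)] /=; rewrite ?asboolT.
Qed.

(** The edge from [ray (i, false)] to [ray (i, true)]: if [n] is a multiple of the
    period, the prefixes of length [n] of its ends are the words of the positions
    [(i, false)] and [(i, true)], and the tails are these rays again. *)
Definition closing_seam
    (t : option position * position * N * option position * position) : Prop :=
  let: (s, (i, b), a, s', (i', b')) := t in
  [/\ i' = i, b = false & b' = true] /\
  [/\ recurring L i, orbit (ray (i, false)), val a = final i,
      s = tail_class (ray (i, false)) & s' = tail_class (ray (i, true))].

Definition closing_gluing : gluing position N :=
  Gluing (fun t => `[< closing_seam t >])
    (fun t : position * option position * position => false).

Definition closable n : Prop := exists C : option position -> nat,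
  (forall s, C s < npatterns position k /\ boundary_pattern bd xi I n (C s)) /\
  forall s d a s' d', closing_seam (s, d, a, s', d') ->
    permits I (colour k (C s) d) a (colour k (C s') d').

(** The colours of the rays with tail [y] give a solution on the words [u] for
    which [u y] is in the orbit; for the other words another tail is chosen. *)
Lemma solvable_closable q :
  domino_solvable (schreier_graph N xi) I -> closable (q * L).
Proof.
move=> /solvableE[tau tauP]; set n := q * L.
pose A u : set (nat -> S) := [set z | orbit (ray_cat u z)].
pose c s u := tau (ray_cat u (favourite xi (tail_ray s) (A u))).
have /choice[C CP] s : exists C, C < npatterns position k /\
    forall d : position, colour k C d = c s (word n d.1 d.2).
  have [|C ltC CE] := @pattern_exists position k (fun d => c s (word n d.1 d.2)) => //.
  by exists C.
exists C; split=> [s|s [i b] a s' [i' b']].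
  have [ltC CE] := CP s; split=> //.
  exists (c s) => [a u su Ou au|i b _]; last exact: CE.
  have actE z : act (val a) (ray_cat u z) = ray_cat (act_word (val a) u) z.
    by rewrite act_ray_cat au act1.
  have AE : A (act_word (val a) u) = A u.
    by apply/seteqP; split=> z; rewrite /A /= -actE => /ray_orbit_act.
  rewrite /c AE -actE; apply: tauP; apply: (favouriteP _ _ (A := A u)).
  exact/orbit_wordP.
move=> [[-> -> ->] [iL Or ai -> ->]].
rewrite (CP _).2 (CP (tail_class (ray (i, true)))).2 /=.
have cE b'' : orbit (ray (i, b'')) ->
    c (tail_class (ray (i, b''))) (word n i b'') = tau (ray (i, b'')).
  have E : ray_cat (word n i b'') (ray (i, b'')) = ray (i, b'').
    have := ray_cat_prefix (ray (i, b'')) n.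
    by rewrite prefix_singular_ray_mul // suffix_singular_ray.
  by move=> Ob; rewrite /c tail_classK favourite_id ?E //= /A /= E.
have actE : act (val a) (ray (i, false)) = ray (i, true) by rewrite ai act_singular_ray.
rewrite !cE //; first by apply/permits_ord; rewrite -actE; exact: tauP.
by rewrite -actE; apply/ray_orbit_act.
Qed.

(** For each [n], colouring a ray according to its prefix of length [n] and the
    class of its tail respects the singular edges and the edges that are trivial
    after [n] letters; so every edge is ultimately respected. *)
Lemma closable_solvable (q0 : nat) :
  (forall q, q0 <= q -> closable (q * L)) ->
  domino_solvable (schreier_graph N xi) I.
Proof.
move=> closed; apply/solvableE.
have cex (t : nat) : exists c : option position -> seq S -> 'I_k,
    (forall s, solves xi ((q0 + t) * L) (c s)) /\
    forall i a, recurring L i -> orbit (ray (i, false)) -> val a = final i ->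
      (c (tail_class (ray (i, false))) (word ((q0 + t) * L) i false), a,
       c (tail_class (ray (i, true))) (word ((q0 + t) * L) i true)) \in allowed I.
  have [C [CP Cseam]] := closed _ (leq_addr t q0); set n := _ * L in CP *.
  have /choice[c cP] s : exists c : seq S -> 'I_k,
      solves xi n c /\ restricts_to bd xi n c (C s).
    by have [_ [c cs cr]] := CP s; exists c.
  exists c; split=> [s|i a iL Or ai]; first by have [] := cP s.
  apply/permits_ord; have [_ cf] := cP (tail_class (ray (i, false))).
  have [_ ct] := cP (tail_class (ray (i, true))).
  rewrite -cf -?ct; first by apply: Cseam; split.
    rewrite -prefix_singular_ray_mul //; apply: orbit_word_prefix_of.
    by rewrite -act_singular_ray //; apply/ray_orbit_act.
  by rewrite -prefix_singular_ray_mul //; exact: orbit_word_prefix_of.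
have [c cP] := choice cex.
pose tau t x :=
  c t (tail_class (suffix_of x ((q0 + t) * L))) (prefix_of x ((q0 + t) * L)).
have [sigma sigmaP] := limit_colouring tau.
exists sigma => a x Ox.
apply: (sigmaP x _ (fun b b' => (b, a, b') \in allowed I)).
have [[n an]|sing] := pselect (exists n, section (val a) (prefix_of x n) = 1%g).
  exists n => t le_n; rewrite /tau; set m := _ * L.
  have am : section (val a) (prefix_of x m) = 1%g.
    have le_m : n <= m by rewrite /m; nia.
    have -> : prefix_of x m = prefix_of x n ++ [seq x p | p <- iota n (m - n)].
      by rewrite /prefix_of /mkseq -{1}(subnKC le_m) iotaD map_cat.
    by rewrite section_cat an section1.
  rewrite suffix_of_act am act1 prefix_of_act; have [csol _] := cP t.
  apply: csol => //; first exact: size_prefix_of.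
  exact: orbit_word_prefix_of.
have [|i [iL ai xE]] := singular_edge L_gt0 prevML full (g := val a) (x := x) (valP a).
  by move=> n an; apply: sing; exists n.
exists 0 => t _; rewrite /tau xE -ai act_singular_ray //.
rewrite !suffix_singular_ray // !prefix_singular_ray_mul //.
by have [_ cs] := cP t; apply: cs => //; rewrite -xE.
Qed.

End Closing.

Section Computation.
Variables (S : finType) (G : selfSimilarGroup S) (N : {fset G}) (bd : boundary N).
Variables (xi : nat -> S) (L n1 : nat) (one : N).
Hypothesis full : exhaustive bd.
Hypothesis one1 : val one = 1%g :> G.
Notation position := (index bd * bool)%type.

Definition level_patterns (I : domino_instance N) n : nat :=
  iteri n (fun n X => glue (level_gluing bd xi n) (domino_code I) X)
    (constant_patterns position one (domino_code I)).

Lemma level_patternsP I n j : j < npatterns position (ncolours I) ->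
  has_pattern (level_patterns I n) j <-> boundary_pattern bd xi I n j.
Proof.
elim: n j => [|n IHn] j lt_j.
  have patP := constant_patternsP one lt_j.
  exact: iff_trans patP (iff_sym (boundary_pattern0 bd xi I j one1)).
have patP := boundary_patternS xi I full n j.
apply: iff_trans (glueP _ _ lt_j) (iff_trans _ (iff_sym patP)).
split=> -[C [CP Cs Co]]; exists C; split=> [s|s d a s' d' /asboolP|d s d' /asboolP].
- by have [ltC /IHn] := CP s; split; auto.
- exact: Cs.
- exact: Co.
- by have [ltC /IHn] := CP s; split; auto.
- exact: Cs.
- exact: Co.
Qed.

Lemma closableP I n : closable bd xi L I n <->
  0 < glue (closing_gluing bd xi L) (domino_code I) (level_patterns I n).
Proof.
split=> [[C [CP Cs]]|gt0].
  have [lt_j _] := CP None.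
  have : has_pattern
      (glue (closing_gluing bd xi L) (domino_code I) (level_patterns I n)) (C None).
    apply/glueP => //; exists C; split=> // [s|s d a s' d' /asboolP]; last exact: Cs.
    by have [ltC /level_patternsP] := CP s; split; auto.
  by rewrite lt0n; apply: contraPneq => ->; rewrite /has_pattern /digit div0n mod0n.
have [j lt_j /glueP] := has_pattern_gt0 (glue_lt _ _ _) gt0.
rewrite logn_domino_code in lt_j => /(_ lt_j)[C [CP Cs _]].
exists C; split=> [s|s d a s' d' sm].
  by have [ltC /level_patternsP] := CP s; split; auto.
by apply: Cs; apply/asboolP.
Qed.

Lemma glue_all_levels I m l :
  glue_all [seq level_gluing bd xi n | n <- iota m l] (domino_code I)
      (level_patterns I m)
    = level_patterns I (m + l).
Proof.
elim: l m => [|l IHl] m; first by rewrite addn0.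
by rewrite addnS -addSn -IHl.
Qed.

Hypothesis periodic :
  forall n, n1 <= n -> level_gluing bd xi (n + L) = level_gluing bd xi n.

Lemma iter_glue_all_levels I t :
  iter t (glue_all [seq level_gluing bd xi n | n <- iota n1 L] (domino_code I))
    (glue_all [seq level_gluing bd xi n | n <- iota 0 n1] (domino_code I)
       (constant_patterns position one (domino_code I)))
  = level_patterns I (n1 + t * L).
Proof.
elim: t => [|t IHt] /=; first by rewrite (glue_all_levels I 0) addn0.
have -> : n1 + t.+1 * L = (n1 + t * L) + L by nia.
rewrite IHt -(glue_all_levels I _ L); congr (glue_all _ _ _).
elim: t {IHt} => [|t IHt]; first by rewrite addn0.
rewrite IHt mulSn addnCA (iotaDl L) -map_comp.
apply/eq_in_map => n; rewrite mem_iota => /andP[le_n _] /=.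
by rewrite addnC periodic //; apply: leq_trans le_n; exact: leq_addr.
Qed.

End Computation.

Theorem theorem1 (S : finType) (G : selfSimilarGroup S) (N : {fset G})
    (xi : nat -> S) (hG : post_critically_finite G) (hN : is_nucleus N) :
  domino_problem_decidable (schreier_graph N xi).
Proof.
have [bd full] := boundary_exists hG hN.
have [M [L [L_gt0 prevML]]] := iter_ultimately_periodic (@prev _ _ _ bd).
pose one : N := [` nucleus1 (xi 0) hN]%fset; have one1 : val one = 1%g by [].
have [n0 n0P] := ultimately_periodic_fin (fun t : index bd * bool * S =>
  orbit_word_ultimately_periodic xi prevML L_gt0 t.1.1 t.1.2 [:: t.2]).
have orbitL (i : index bd) b s n : n0 <= n ->
    orbit_word G xi (rcons (word (n + L) i b) s) =
    orbit_word G xi (rcons (word n i b) s).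
  by move=> le_n; apply/propext; rewrite -!cats1; split=> /(n0P (i, b, s) _ le_n).
(* Gluings are periodic beyond [q0 * L], a multiple of the period [L]. *)
pose q0 := n0 + M.
have periodic n : q0 * L <= n -> level_gluing bd xi (n + L) = level_gluing bd xi n.
  move=> le_n; have [le_n0 le_M] : n0 <= n /\ M <= n by split; rewrite /q0 in le_n; nia.
  congr Gluing; apply/funext.
    move=> [[[[s [i b]] a] s'] [i' b']]; congr asbool; rewrite /seam_between.
    by rewrite (initial_periodic prevML) // orbitL.
  move=> [[[i b] s] [i' b']]; congr asbool; rewrite /outlet_from /=.
  by rewrite orbitL.
apply: (@gluing_decidable _ _ one
  [seq level_gluing bd xi n | n <- iota 0 (q0 * L)]
  [seq level_gluing bd xi n | n <- iota (q0 * L) L]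
  (closing_gluing bd xi L)) => I.
have E t : closable bd xi L I ((q0 + t) * L) <->
    0 < glue (closing_gluing bd xi L) (domino_code I)
      (level_patterns bd xi one I (q0 * L + t * L)).
  rewrite mulnDl; exact: (closableP xi L full one1 I).
split=> [sol t|H].
  by rewrite (iter_glue_all_levels one periodic); apply/E; exact: solvable_closable.
apply: (closable_solvable L_gt0 prevML full (q0 := q0)) => q le_q.
rewrite -(subnKC le_q); apply/E.
by have := H (q - q0); rewrite (iter_glue_all_levels one periodic).
Qed.
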